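(* Let $V,W\subset X$ be $p$-dimensional subspaces ($p\geq1$) of a Euclidean space $X$, with associated principal bases $\beta_V=(e_1,\ldots,e_p)$ and $\beta_W=(f_1,\ldots,f_p)$, let $\Phi_{V,W}$ be the angle bivector formed with these bases, and let $d=\dim(V\cap W)$. With the coordinate blades $C_{\mathbf j}$, the coordinate $p$-subspaces $Y_{\mathbf j}=[C_{\mathbf j}]$ and the map $\sigma$ defined in the context, $$e^{\Phi_{V,W}} = \sum_{\mathbf j\in\mathcal I_p^{2p-d}} \cos\Theta_{V,Y_{\mathbf j}}\;\sigma(C_{\mathbf j}) = \sum_{\mathbf j\in\mathcal I_p^{2p-d}} \pi_{V,Y_{\mathbf j}}\;\sigma(C_{\mathbf j}).$$
   Context: $X$ is an $n$-dimensional Euclidean space. $\bigwedge X$ is its exterior algebra, equipped with the Clifford geometric product (written by juxtaposition), for which $vw=v\cdot w+v\wedge w$ for $v,w\in X$. $\bigwedge X$ carries the usual inner product and norm $\|\cdot\|$. For $M\in\bigwedge X$, $e^M=\sum_{k\ge0}M^k/k!$. For a nonzero blade $B=v_1\wedge\cdots\wedge v_p$, $[B]=\mathrm{span}(v_1,\ldots,v_p)$. Principal angles $0\le\theta_1\le\cdots\le\theta_p\le\frac\pi2$ of $V,W$ and associated principal bases (orthonormal bases) $(e_i)$ of $V$ and $(f_i)$ of $W$ are characterized by $e_i\cdot f_j=\delta_{ij}\cos\theta_i$ for all $i,j$. Principal bivectors: $I_i=0$ for $i\le d$, and $I_i=\frac{e_i\wedge f_i}{\|e_i\wedge f_i\|}$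 for $i>d$. The angle bivector is $\Phi_{V,W}=\sum_{i=1}^p\theta_iI_i$. For $i>d$ let $e_i^\perp=I_if_i$, which is the normalized component of $e_i$ orthogonal to $W$. Let $Y=V+W$, with orthonormal basis $\beta_Y=(f_1,\ldots,f_d,e_{d+1}^\perp,f_{d+1},\ldots,e_p^\perp,f_p)=(y_1,\ldots,y_{2p-d})$. Let $\mathcal I_p^{2p-d}=\{(j_1,\ldots,j_p)\in\mathbb N^p:1\le j_1<\cdots<j_p\le 2p-d\}$. For $\mathbf j=(j_1,\ldots,j_p)\in\mathcal I^{2p-d}_p$, the coordinate blade is $C_{\mathbf j}=y_{j_1}y_{j_2}\cdots y_{j_p}$ and $Y_{\mathbf j}=[C_{\mathbf j}]$. With $F=f_1f_2\cdots f_p$, the map $\sigma:\bigwedge Y\to\bigwedge Y$ is $\sigma(C)=CF^{-1}=Cf_p\cdots f_1$. Projection factor and asymmetric angle: for subspaces $V,U\subset X$ with $\dim V=p$, $P_U$ the orthogonal projection onto $U$, and $S\subset V$ any non-degenerate $p$-dimensional parallelotope, $\pi_{V,U}=\frac{\mathrm{vol}_p(P_U(S))}{\mathrm{vol}_p(S)}$, where $\mathrm{vol}_p$ is the $p$-dimensional volume, and $\Theta_{V,U}\in[0,\frac\pi2]$ is given by $\cos\Theta_{V,U}=\pi_{V,U}$. *)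

(* Defs.v *)
From HB Require Import structures.
From mathcomp Require Import boolp classical_sets.
From mathcomp Require Import all_boot all_order all_algebra.
From mathcomp Require Import ring lra.
From mathcomp Require Import reals topology normedtype sequences trigo.

Set Implicit Arguments.
Unset Strict Implicit.
Unset Printing Implicit Defensive.

Import Order.TTheory GRing.Theory Num.Theory numFieldNormedType.Exports.

Local Open Scope ring_scope.

Section SymDiff.
Variable n : nat.
Implicit Types (A B C : {set 'I_n}).

Definition symdiff A B : {set 'I_n} := (A :\: B) :|: (B :\: A).

Lemma in_symdiff A B i : (i \in symdiff A B) = (i \in A) (+) (i \in B).
Proof. by rewrite !inE; case: (i \in A); case: (i \in B). Qed.

Lemma symdiffC A B : symdiff A B = symdiff B A.
Proof. by apply/setP => i; rewrite !in_symdiff addbC. Qed.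

Lemma symdiffA A B C : symdiff A (symdiff B C) = symdiff (symdiff A B) C.
Proof. by apply/setP => i; rewrite !in_symdiff addbA. Qed.

Lemma symdiff0s A : symdiff set0 A = A.
Proof. by apply/setP => i; rewrite in_symdiff !inE. Qed.

Lemma symdiffs0 A : symdiff A set0 = A.
Proof. by rewrite symdiffC symdiff0s. Qed.

Lemma symdiffss A : symdiff A A = set0.
Proof. by apply/setP => i; rewrite in_symdiff !inE addbb. Qed.

Lemma symdiffK A B : symdiff A (symdiff A B) = B.
Proof. by rewrite symdiffA symdiffss symdiff0s. Qed.

Lemma symdiff_eq A B C : (symdiff A B == C) = (B == symdiff A C).
Proof.
by apply/eqP/eqP => [<-|->]; rewrite symdiffK.
Qed.

End SymDiff.

Section ReorderSign.
Variables (R : realType) (n : nat).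
Implicit Types (S T U : {set 'I_n}).

(* The sign of the reordering of x_S x_T into increasing order, where
   x_S is the product of the basis vectors x_i (i \in S) in increasing order:
   one factor -1 for each pair (i, j) in S * T with j < i. *)
Definition reorder_sign S T : R :=
  \prod_(i in S) \prod_(j in T) (-1) ^+ (j < i)%N.

Lemma prod_symdiff (F : 'I_n -> R) S T : (forall i, F i * F i = 1) ->
  \prod_(i in symdiff S T) F i = (\prod_(i in S) F i) * \prod_(i in T) F i.
Proof.
move=> F2; rewrite big_mkcond (big_mkcond (mem S)) (big_mkcond (mem T)) /=.
rewrite -big_split /=; apply: eq_bigr => i _; rewrite in_symdiff.
by case: (i \in S); case: (i \in T); rewrite /= ?mul1r ?mulr1 ?F2.
Qed.

Lemma sgn_sq (b : bool) : (-1) ^+ b * (-1) ^+ b = 1 :> R.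
Proof. by rewrite -expr2 sqrr_sign. Qed.

Lemma reorder_signDl S T U :
  reorder_sign (symdiff S T) U = reorder_sign S U * reorder_sign T U.
Proof.
apply: prod_symdiff => i; rewrite -big_split /=.
by rewrite big1 // => j _; rewrite sgn_sq.
Qed.

Lemma reorder_signDr S T U :
  reorder_sign S (symdiff T U) = reorder_sign S T * reorder_sign S U.
Proof.
rewrite -big_split /=; apply: eq_bigr => i _.
by apply: prod_symdiff => j; rewrite sgn_sq.
Qed.

Lemma reorder_sign0s S : reorder_sign set0 S = 1.
Proof. by rewrite /reorder_sign big_set0. Qed.

Lemma reorder_signs0 S : reorder_sign S set0 = 1.
Proof. by rewrite /reorder_sign big1 // => i _; rewrite big_set0. Qed.

Lemma reorder_sign11 i j : reorder_sign [set i] [set j] = (-1) ^+ (j < i)%N.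
Proof. by rewrite /reorder_sign !big_set1. Qed.

End ReorderSign.

(* The exterior algebra of the Euclidean space 'rV[R]_n: M S is the coordinate
   of M on x_S = x_i1 /\ ... /\ x_ik for S = {i1 < ... < ik}, where
   x_0, ..., x_(n-1) is the canonical basis; the x_S are orthonormal. *)
Definition multivector (R : realType) (n : nat) := {ffun {set 'I_n} -> R}.

HB.instance Definition _ (R : realType) (n : nat) :=
  GRing.Lmodule.copy (multivector R n) {ffun {set 'I_n} -> R}.

Section GeometricProduct.
Variables (R : realType) (n : nat).
Implicit Types (S T U : {set 'I_n}) (M N K : multivector R n).

Definition mvbasis S : multivector R n := [ffun T => (T == S)%:R].

(* x_S x_T = reorder_sign S T * x_(S delta T), since x_i x_i = 1 and
   x_i x_j = - x_j x_i for i != j. *)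
Definition gmul M N : multivector R n :=
  [ffun U => \sum_S \sum_(T | symdiff S T == U) reorder_sign R S T * M S * N T].

Lemma gmulE M N U : gmul M N U =
  \sum_S reorder_sign R S (symdiff S U) * M S * N (symdiff S U).
Proof.
rewrite ffunE; apply: eq_bigr => S _.
by rewrite (eq_bigl (pred1 (symdiff S U))) ?big_pred1_eq // => T; rewrite /= symdiff_eq.
Qed.

Lemma gmulA : associative gmul.
Proof.
move=> M N K; apply/ffunP => U; rewrite !gmulE.
under [RHS]eq_bigr => T _.
  rewrite gmulE mulr_sumr mulr_suml; over.
rewrite exchange_big /=; apply: eq_bigr => S _.
rewrite gmulE mulr_sumr (reindex_inj (can_inj (symdiffK S))) /=.
apply: eq_bigr => T _.
have -> : symdiff (symdiff S T) (symdiff S U) = symdiff T U.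
  by rewrite (symdiffC S T) -symdiffA symdiffK.
have -> : reorder_sign R S (symdiff S U) =
  reorder_sign R S (symdiff S T) * reorder_sign R S (symdiff T U).
  by rewrite -reorder_signDr -symdiffA symdiffK.
have -> : reorder_sign R T (symdiff T U) = reorder_sign R S (symdiff T U) *
  reorder_sign R (symdiff S T) (symdiff T U).
  by rewrite -reorder_signDl symdiffK.
by ring.
Qed.

Definition gone : multivector R n := mvbasis set0.

Lemma gmul1l : left_id gone gmul.
Proof.
move=> M; apply/ffunP => U; rewrite gmulE (bigD1 set0) //= big1 => [|S /negPf S0].
  by rewrite symdiff0s reorder_sign0s ffunE eqxx !mul1r addr0.
by rewrite ffunE S0 mulr0 mul0r.
Qed.

Lemma gmul1r : right_id gone gmul.
Proof.
move=> M; apply/ffunP => U; rewrite gmulE (bigD1 U) //= big1 => [|S SU].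
  by rewrite symdiffss reorder_signs0 ffunE eqxx mulr1 mul1r addr0.
by rewrite ffunE symdiff_eq symdiffs0 eq_sym (negPf SU) mulr0.
Qed.

Lemma gmulDl : left_distributive gmul +%R.
Proof.
move=> M N K; apply/ffunP => U; rewrite [RHS]ffunE !gmulE -big_split.
by apply: eq_bigr => S _; rewrite ffunE mulrDr mulrDl.
Qed.

Lemma gmulDr : right_distributive gmul +%R.
Proof.
move=> M N K; apply/ffunP => U; rewrite [RHS]ffunE !gmulE -big_split.
by apply: eq_bigr => S _; rewrite ffunE mulrDr.
Qed.

Lemma gone_neq0 : gone != 0.
Proof. by apply/eqP => /ffunP /(_ set0)/eqP; rewrite !ffunE eqxx oner_eq0. Qed.

HB.instance Definition _ := GRing.Zmodule_isNzRing.Build (multivector R n)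
  gmulA gmul1l gmul1r gmulDl gmulDr gone_neq0.

Lemma mvmulE M N U : (M * N) U =
  \sum_S reorder_sign R S (symdiff S U) * M S * N (symdiff S U).
Proof. exact: gmulE. Qed.

Lemma mvscaleE (a : R) M U : (a *: M) U = a * M U.
Proof. by rewrite ffunE. Qed.

Lemma gscalAl (a : R) M N : a *: (M * N) = (a *: M) * N.
Proof.
apply/ffunP => U; rewrite mvscaleE !mvmulE mulr_sumr.
by apply: eq_bigr => S _; rewrite mvscaleE; ring.
Qed.

Lemma gscalAr (a : R) M N : a *: (M * N) = M * (a *: N).
Proof.
apply/ffunP => U; rewrite mvscaleE !mvmulE mulr_sumr.
by apply: eq_bigr => S _; rewrite mvscaleE; ring.
Qed.

HB.instance Definition _ :=
  GRing.Lmodule_isLalgebra.Build R (multivector R n) gscalAl.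
HB.instance Definition _ :=
  GRing.Lalgebra_isAlgebra.Build R (multivector R n) gscalAr.

End GeometricProduct.

Section Norm.
Variables (R : realType) (n : nat).
Implicit Types (M N : multivector R n).

Definition mvdot M N : R := \sum_S M S * N S.

Definition mvnorm M : R := Num.sqrt (mvdot M M).

Lemma mvdot_ge0 M : 0 <= mvdot M M.
Proof. by apply: sumr_ge0 => S _; rewrite -expr2 sqr_ge0. Qed.

Lemma mvdot_CS M N : mvdot M N ^+ 2 <= mvdot M M * mvdot N N.
Proof.
have : 0 <= \sum_S \sum_T (M S * N T - M T * N S) ^+ 2.
  by apply: sumr_ge0 => S _; apply: sumr_ge0 => T _; rewrite sqr_ge0.
have E : forall A B C D : multivector R n,
  \sum_S \sum_T (A S * B S) * (C T * D T) = mvdot A B * mvdot C D.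
  move=> A B C D; rewrite /mvdot mulr_suml; apply: eq_bigr => S _.
  by rewrite mulr_sumr.
have -> : \sum_S \sum_T (M S * N T - M T * N S) ^+ 2 =
   (mvdot M M * mvdot N N - mvdot M N * mvdot M N) +
   (mvdot N N * mvdot M M - mvdot M N * mvdot M N).
  rewrite -!E -!sumrB -big_split /=; apply: eq_bigr => S _.
  rewrite -!sumrB -big_split /=; apply: eq_bigr => T _.
  by ring.
by move=> h; rewrite expr2; lra.
Qed.

Lemma mvnormD M N : mvnorm (M + N) <= mvnorm M + mvnorm N.
Proof.
rewrite -(@ler_pXn2r _ 2%N) // ?nnegrE ?addr_ge0 ?sqrtr_ge0 //.
rewrite sqrrD !sqr_sqrtr ?mvdot_ge0 //.
have -> : mvdot (M + N) (M + N) = mvdot M M + mvdot M N *+ 2 + mvdot N N.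
  rewrite /mvdot -sumrMnl -!big_split /=; apply: eq_bigr => S _.
  by rewrite !ffunE; ring.
rewrite lerD2r lerD2l lerMn2r /= -sqrtrM ?mvdot_ge0 //.
by rewrite (le_trans (ler_norm _)) // -sqrtr_sqr ler_wsqrtr // mvdot_CS.
Qed.

Lemma mvnormZ (a : R) M : mvnorm (a *: M) = `|a| * mvnorm M.
Proof.
have -> : mvnorm (a *: M) = Num.sqrt (a ^+ 2 * mvdot M M).
  congr Num.sqrt; rewrite /mvdot mulr_sumr; apply: eq_bigr => S _.
  by rewrite !mvscaleE; ring.
by rewrite sqrtrM ?sqr_ge0 // sqrtr_sqr.
Qed.

Lemma mvnorm0_eq0 M : mvnorm M = 0 -> M = 0.
Proof.
move/eqP; rewrite sqrtr_eq0 => M0.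
have /eqP : mvdot M M = 0 by apply/eqP; rewrite eq_le M0 mvdot_ge0.
rewrite psumr_eq0 => [/allP h|S _]; last by rewrite -expr2 sqr_ge0.
apply/ffunP => S; rewrite ffunE; apply/eqP.
by have := h S (mem_index_enum _); rewrite /= mulf_eq0 orbb.
Qed.

HB.instance Definition _ := Lmodule_isNormed.Build R (multivector R n)
  mvnormD mvnormZ mvnorm0_eq0.

Lemma mvnormE M : `|M| = mvnorm M. Proof. by []. Qed.

End Norm.

Section Euclidean.
Variables (R : realType) (n : nat).
Implicit Types (u v w x : 'rV[R]_n) (U V W : {vspace 'rV[R]_n}).

Definition dotv u v : R := \sum_i u 0 i * v 0 i.

Lemma dotvC u v : dotv u v = dotv v u.
Proof. by apply: eq_bigr => i _; rewrite mulrC. Qed.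

Lemma dotvDl u v w : dotv (u + v) w = dotv u w + dotv v w.
Proof. by rewrite -big_split; apply: eq_bigr => i _; rewrite mxE mulrDl. Qed.

Lemma dotvZl (a : R) u v : dotv (a *: u) v = a * dotv u v.
Proof. by rewrite mulr_sumr; apply: eq_bigr => i _; rewrite mxE mulrA. Qed.

Lemma dotvDr u v w : dotv u (v + w) = dotv u v + dotv u w.
Proof. by rewrite dotvC dotvDl !(dotvC u). Qed.

Lemma dotvZr (a : R) u v : dotv u (a *: v) = a * dotv u v.
Proof. by rewrite dotvC dotvZl (dotvC u). Qed.

Lemma dotvNl u v : dotv (- u) v = - dotv u v.
Proof. by rewrite -scaleN1r dotvZl mulN1r. Qed.

Lemma dotvNr u v : dotv u (- v) = - dotv u v.
Proof. by rewrite dotvC dotvNl dotvC. Qed.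

Lemma dotv0l v : dotv 0 v = 0.
Proof. by rewrite -(scale0r 0) dotvZl mul0r. Qed.

Lemma dotv0r v : dotv v 0 = 0.
Proof. by rewrite dotvC dotv0l. Qed.

Lemma dotv_suml (I : Type) (r : seq I) (P : pred I) (F : I -> 'rV[R]_n) v :
  dotv (\sum_(i <- r | P i) F i) v = \sum_(i <- r | P i) dotv (F i) v.
Proof. by elim/big_rec2: _ => [|i a b _ <-]; rewrite ?dotv0l ?dotvDl. Qed.

Lemma dotv_sumr (I : Type) (r : seq I) (P : pred I) (F : I -> 'rV[R]_n) v :
  dotv v (\sum_(i <- r | P i) F i) = \sum_(i <- r | P i) dotv v (F i).
Proof. by rewrite dotvC dotv_suml; apply: eq_bigr => i _; rewrite dotvC. Qed.

Lemma dotvv_eq0 v : (dotv v v == 0) = (v == 0).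
Proof.
apply/eqP/eqP => [/eqP|->]; last by rewrite dotv0l.
rewrite psumr_eq0 => [/allP h|i _]; last by rewrite -expr2 sqr_ge0.
apply/rowP => i; rewrite mxE; apply/eqP.
by have := h i (mem_index_enum _); rewrite /= mulf_eq0 orbb.
Qed.

Lemma dotv_orth_span (s : seq 'rV[R]_n) x :
  {in s, forall v, dotv x v = 0} -> {in <<s>>%VS, forall w, dotv x w = 0}.
Proof.
move=> h w hw; rewrite (@coord_span _ _ _ (in_tuple s) w hw) dotv_sumr big1 // => i _.
by rewrite dotvZr h ?mulr0 // mem_nth.
Qed.

(* The orthogonal projection onto U: the choice is unique, see orthprojP and
   orthproj_uniq. *)
Definition orthproj U x : 'rV[R]_n :=
  xget 0 [set u | u \in U /\ forall w, w \in U -> dotv (x - u) w = 0]%classic.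

Lemma orthproj_subproof U x :
  exists u, u \in U /\ forall w, w \in U -> dotv (x - u) w = 0.
Proof.
pose B := \matrix_(i < \dim U) (vbasis U)`_i.
pose f : 'Hom('rV[R]_n, 'rV[R]_(\dim U)) := linfun (mulmxr B^T).
have fE y i : f y 0 i = dotv y (vbasis U)`_i.
  rewrite lfunE /= mxE; apply: eq_bigr => j _.
  by rewrite !mxE.
have f0 y : f y = 0 -> {in U, forall w, dotv y w = 0}.
  move=> fy w; rewrite -{1}(span_basis (vbasisP U)) => wU.
  apply: dotv_orth_span wU => v /(nthP 0) [i].
  by rewrite size_tuple => iU <-; rewrite -(fE y (Ordinal iU)) fy mxE.
have kerf : (U :&: lker f = 0)%VS.
  apply/eqP; rewrite -subv0; apply/subvP => y /memv_capP [yU].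
  rewrite memv_ker memv0 => /eqP fy.
  by rewrite -dotvv_eq0 (f0 _ fy).
have imf : (f @: U = fullv)%VS.
  apply/eqP; rewrite eqEdim subvf limg_dim_eq // dimvf /=.
  by rewrite /dim /= mul1n.
have : f x \in (f @: U)%VS by rewrite imf memvf.
case/memv_imgP => u uU fxu; exists u; split => // w wU.
by apply: f0 wU; rewrite linearB /= fxu subrr.
Qed.

Lemma orthprojP U x :
  orthproj U x \in U /\ forall w, w \in U -> dotv (x - orthproj U x) w = 0.
Proof.
have [u hu] := orthproj_subproof U x.
exact: (xgetPex 0 (ex_intro
  [set u | u \in U /\ forall w, w \in U -> dotv (x - u) w = 0]%classic u hu)).
Qed.

Lemma orthproj_uniq U x u : u \in U ->
  (forall w, w \in U -> dotv (x - u) w = 0) -> orthproj U x = u.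
Proof.
move=> uU hu; have [pU hp] := orthprojP U x.
apply/eqP; rewrite -subr_eq0 -dotvv_eq0.
have dU : orthproj U x - u \in U by rewrite memvB.
have {1}-> : orthproj U x - u = (x - u) - (x - orthproj U x).
  by rewrite opprB addrCA addrAC subrr add0r addrC.
by rewrite dotvDl dotvNl hu // hp // subrr.
Qed.

Lemma orthproj_linear U : linear (orthproj U).
Proof.
move=> a x y; have [xU hx] := orthprojP U x; have [yU hy] := orthprojP U y.
apply: orthproj_uniq => [|w wU]; first by rewrite memvD // memvZ.
have -> : a *: x + y - (a *: orthproj U x + orthproj U y) =
  a *: (x - orthproj U x) + (y - orthproj U y).
  by rewrite scalerBr opprD addrACA.
by rewrite dotvDl dotvZl hx // hy // mulr0 addr0.
Qed.

HB.instance Definition _ U :=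
  GRing.isLinear.Build R 'rV[R]_n 'rV[R]_n _ (orthproj U) (orthproj_linear U).

(* The p-dimensional volume of the parallelotope spanned by the edges s. *)
Definition gram p (s : p.-tuple 'rV[R]_n) : 'M[R]_p :=
  \matrix_(i, j) dotv (tnth s i) (tnth s j).
Definition pvol p (s : p.-tuple 'rV[R]_n) : R := Num.sqrt (\det (gram s)).

(* vol_p (P_U S) / vol_p S for the parallelotope S spanned by a basis of V;
   the choice of S is irrelevant by proj_factorE. *)
Definition proj_factor V U : R :=
  pvol [tuple of map (orthproj U) (vbasis V)] / pvol (vbasis V).

(* In [0, pi/2], as 0 <= proj_factor V U <= 1. *)
Definition asym_angle V U : R := acos (proj_factor V U).

Lemma gram_comb p (s t : p.-tuple 'rV[R]_n) (A : 'M[R]_p) :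
  (forall i, tnth s i = \sum_j A i j *: tnth t j) -> gram s = A *m gram t *m A^T.
Proof.
move=> h; apply/matrixP => i j; rewrite !mxE !h dotv_sumr.
apply: eq_bigr => k _; rewrite dotvZr dotv_suml !mxE mulrC; congr (_ * _).
by apply: eq_bigr => l _; rewrite dotvZl mxE.
Qed.

Lemma gram_unit p V (s : p.-tuple 'rV[R]_n) : basis_of V s -> gram s \in unitmx.
Proof.
move=> /basis_free frs; rewrite -row_free_unit -kermx_eq0.
apply/rowV0P => a /sub_kermxP a0.
pose w := \sum_j a 0 j *: tnth s j.
have e j : dotv w (tnth s j) = 0.
  have := congr1 (fun m : 'rV[R]_p => m 0 j) a0; rewrite !mxE => <-.
  by rewrite dotv_suml; apply: eq_bigr => k _; rewrite dotvZl mxE.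
have : dotv w w == 0.
  by rewrite {2}/w dotv_sumr big1 // => j _; rewrite dotvZr e mulr0.
rewrite dotvv_eq0 => /eqP w0; apply/rowP => j; rewrite mxE.
move/freeP: frs => /(_ (a 0)); apply; rewrite -[RHS]w0.
by apply: eq_bigr => i _; rewrite (tnth_nth 0).
Qed.

Lemma proj_factorE p V U (b : p.-tuple 'rV[R]_n) : \dim V = p -> basis_of V b ->
  proj_factor V U = pvol [tuple of map (orthproj U) b] / pvol b.
Proof.
move=> dV; subst p => bV.
pose A := \matrix_(i, j) coord (vbasis V) j (tnth b i).
have bE i : tnth b i = \sum_j A i j *: tnth (vbasis V) j.
  have bi : tnth b i \in V.
    by apply: (basis_mem bV); apply: mem_tnth.
  apply: etrans (coord_vbasis bi) _.
  by apply: eq_bigr => j _; rewrite mxE -tnth_nth.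
have gE := gram_comb bE.
have pE : gram [tuple of map (orthproj U) b] =
    A *m gram [tuple of map (orthproj U) (vbasis V)] *m A^T.
  apply: gram_comb => i; rewrite tnth_map bE linear_sum.
  by apply: eq_bigr => j _; rewrite linearZ tnth_map.
have A0 : \det A != 0.
  have := gram_unit bV; rewrite unitmxE unitfE gE !det_mulmx !mulf_eq0.
  by case: eqP.
rewrite /proj_factor /pvol gE pE !det_mulmx !det_tr.
have sE (a : R) : Num.sqrt (\det A * a * \det A) = `|\det A| * Num.sqrt a.
  by rewrite mulrAC -expr2 sqrtrM ?sqr_ge0 // sqrtr_sqr.
by rewrite !sE -mulf_div divff ?mul1r // normr_eq0.
Qed.

End Euclidean.

Section Blades.
Variables (R : realType) (n : nat).
Implicit Types (u v w x : 'rV[R]_n) (S T U : {set 'I_n}).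
Implicit Types (M N B : multivector R n).

Definition vec v : multivector R n := \sum_i v 0 i *: mvbasis R [set i].

Definition vecpart M : 'rV[R]_n := \row_i M [set i].

Definition wedge M N : multivector R n :=
  [ffun U => \sum_(S : {set 'I_n})
               \sum_(T : {set 'I_n} | [disjoint S & T] && (S :|: T == U))
                 reorder_sign R S T * M S * N T].

Definition wedges (s : seq 'rV[R]_n) : multivector R n :=
  foldr (fun v B => wedge (vec v) B) 1 s.

(* [B] = span(v_1, ..., v_p) for B = v_1 /\ ... /\ v_p != 0; independent of
   the chosen factorization by blade_spaceE. *)
Definition blade_space B : {vspace 'rV[R]_n} :=
  <<xget [::] [set s | B = wedges s]%classic>>%VS.

Lemma mvaddE M N U : (M + N) U = M U + N U. Proof. by rewrite ffunE. Qed.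

Lemma mvsumE (I : Type) (r : seq I) (P : pred I) (F : I -> multivector R n) U :
  (\sum_(i <- r | P i) F i) U = \sum_(i <- r | P i) F i U.
Proof. exact: sum_ffunE. Qed.

Lemma vecE v S : vec v S = \sum_i v 0 i * (S == [set i]%SET)%:R.
Proof. by rewrite mvsumE; apply: eq_bigr => i _; rewrite mvscaleE ffunE. Qed.

Lemma vecK : cancel vec vecpart.
Proof.
move=> v; apply/rowP => i; rewrite mxE vecE (bigD1 i) //= eqxx mulr1.
rewrite big1 ?addr0 // => j ji; rewrite (inj_eq set1_inj) eq_sym (negPf ji).
by rewrite mulr0.
Qed.

Lemma vec_linear : linear vec.
Proof.
move=> a u v; apply/ffunP => S; rewrite mvaddE mvscaleE !vecE mulr_sumr.
by rewrite -big_split /=; apply: eq_bigr => i _; rewrite !mxE; ring.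
Qed.

HB.instance Definition _ :=
  GRing.isLinear.Build R 'rV[R]_n (multivector R n) _ vec vec_linear.

Lemma vecZ (a : R) v : vec (a *: v) = a *: vec v.
Proof. exact: linearZ. Qed.

Lemma vecB v w : vec (v - w) = vec v - vec w.
Proof. exact: linearB. Qed.

(* The parts of vec v * M of higher (b = true) and lower (b = false) grade. *)
Definition vop (b : bool) v M : multivector R n :=
  [ffun U : {set 'I_n} => \sum_i v 0 i * (((i \in U) == b)%:R *
     reorder_sign R [set i] (symdiff [set i] U) * M (symdiff [set i] U))].

Lemma sum_vecE (F : {set 'I_n} -> R) v :
  \sum_S vec v S * F S = \sum_i v 0 i * F [set i].
Proof.
under eq_bigr => S _ do rewrite vecE mulr_suml.
rewrite exchange_big /=; apply: eq_bigr => i _.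
rewrite (bigD1 [set i]) //= eqxx mulr1 big1 ?addr0 // => S /negPf ->.
by rewrite mulr0 mul0r.
Qed.

Lemma vec_mulE v M : vec v * M = vop true v M + vop false v M.
Proof.
apply/ffunP => U; rewrite mvaddE mvmulE !ffunE -big_split /=.
under eq_bigr => S _ do rewrite (mulrC (reorder_sign _ _ _)) -mulrA.
rewrite (sum_vecE (fun S => reorder_sign R S (symdiff S U) * M (symdiff S U))).
apply: eq_bigr => i _; case: (i \in U); rewrite /= !(mul0r, mul1r, mulr0).
  by rewrite addr0.
by rewrite add0r.
Qed.

Lemma wedge_vecE v M : wedge (vec v) M = vop true v M.
Proof.
apply/ffunP => U; rewrite !ffunE.
under eq_bigr => S _.
  under eq_bigr => T _ do rewrite (mulrC (reorder_sign _ _ _)) -mulrA.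
  rewrite -mulr_sumr; over.
rewrite (sum_vecE (fun S : {set 'I_n} => \sum_(T : {set 'I_n} | [disjoint S & T] && (S :|: T == U))
   reorder_sign R S T * M T)).
apply: eq_bigr => i _; congr (_ * _); rewrite eqb_id.
have [iU|iU] := boolP (i \in U); last first.
  rewrite !mul0r big_pred0 // => T; apply/negP => /andP [_ /eqP TU].
  by move: iU; rewrite -TU !inE eqxx.
rewrite mul1r (eq_bigl (pred1 (symdiff [set i] U))) ?big_pred1_eq // => T.
rewrite /= disjoints1; apply/andP/eqP => [[iT /eqP <-]|->].
  apply/setP => j; rewrite in_symdiff !inE.
  by case: eqP => [->|_] //=; rewrite ?(negPf iT).
rewrite in_symdiff inE eqxx iU; split => //; apply/eqP/setP => j.
by rewrite !(in_symdiff, inE); case: eqP => [->|_]; rewrite ?iU.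
Qed.

Lemma reorder_sign_sq S T : reorder_sign R S T * reorder_sign R S T = 1.
Proof. by rewrite -reorder_signDl symdiffss reorder_sign0s. Qed.

Lemma vop_anticomm b c v w M :
  vop b v (vop c w M) + vop c w (vop b v M) = ((b != c)%:R * dotv v w) *: M.
Proof.
apply/ffunP => U; rewrite mvaddE mvscaleE.
pose s i T := reorder_sign R [set i] (symdiff [set i] T).
pose t b c i k := ((i \in U) == b)%:R * s i U *
  (((k \in symdiff [set i] U) == c)%:R * s k (symdiff [set i] U) *
   M (symdiff [set k] (symdiff [set i] U))).
have E b' c' v' w' : vop b' v' (vop c' w' M) U =
    \sum_i \sum_k v' 0 i * w' 0 k * t b' c' i k.
  rewrite ffunE; apply: eq_bigr => i _; rewrite ffunE !mulr_sumr.
  by apply: eq_bigr => k _; rewrite /t /s; ring.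
rewrite !E [X in _ + X]exchange_big -big_split /= /dotv mulr_sumr mulr_suml.
apply: eq_bigr => i _; rewrite -big_split (bigD1 i) //= big1 ?addr0 => [|k ki].
  rewrite /t !symdiffK !in_symdiff !inE eqxx /=.
  have -> : s i (symdiff [set i] U) = s i U.
    rewrite /s symdiffK reorder_signDr reorder_sign11 ltnn mul1r.
    by [].
  transitivity (v 0 i * w 0 i * ((((i \in U) == b) * (~~ (i \in U) == c) +
     ((i \in U) == c) * (~~ (i \in U) == b))%:R * (s i U * s i U) * M U)).
    by rewrite natrD !natrM; ring.
  rewrite reorder_sign_sq mulr1.
  by case: (i \in U); case: b; case: c; rewrite /=; ring.
have h j l : l != j -> (l \in symdiff [set j] U) = (l \in U).
  by move=> lj; rewrite in_symdiff inE (negPf lj).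
rewrite /t (h i k ki) (h k i) 1?eq_sym // symdiffA (symdiffC [set k]) -symdiffA.
have sE j l : s j (symdiff [set l] U) = reorder_sign R [set j] [set l] * s j U.
  by rewrite /s -reorder_signDr !symdiffA (symdiffC [set l]).
have si : reorder_sign R [set k] [set i] = - reorder_sign R [set i] [set k].
  rewrite !reorder_sign11; move: ki; rewrite neq_ltn.
  by case: ltngtP => // _ _; rewrite /= expr0 expr1 ?opprK.
by rewrite !sE si; ring.
Qed.

Lemma vopD b v M N : vop b v (M + N) = vop b v M + vop b v N.
Proof.
apply/ffunP => U; rewrite mvaddE !ffunE -big_split; apply: eq_bigr => i _.
by rewrite mvaddE /=; ring.
Qed.

Lemma vopZ b v (a : R) M : vop b v (a *: M) = a *: vop b v M.
Proof.
apply/ffunP => U; rewrite mvscaleE !ffunE mulr_sumr; apply: eq_bigr => i _.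
by rewrite mvscaleE /=; ring.
Qed.

Lemma vop0 b v : vop b v 0 = 0.
Proof. by rewrite -(scale0r 0) vopZ !scale0r. Qed.

Lemma vopl_sum b (I : Type) (r : seq I) (a : I -> R) (F : I -> 'rV[R]_n) M :
  vop b (\sum_(k <- r) a k *: F k) M = \sum_(k <- r) a k *: vop b (F k) M.
Proof.
apply/ffunP => U; rewrite mvsumE ffunE.
under [RHS]eq_bigr => k _ do rewrite mvscaleE ffunE mulr_sumr.
rewrite exchange_big; apply: eq_bigr => i _.
rewrite summxE mulr_suml; apply: eq_bigr => k _; rewrite mxE /=.
by ring.
Qed.

Lemma vopF1 v : vop false v 1 = 0.
Proof.
apply/ffunP => U; rewrite !ffunE big1 // => i _.
rewrite ffunE symdiff_eq symdiffs0; case: (U =P _) => [->|_]; last by rewrite !mulr0.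
by rewrite !inE eqxx /= !(mul0r, mulr0).
Qed.

Lemma wedges_cons v s : wedges (v :: s) = vop true v (wedges s).
Proof. by rewrite /= wedge_vecE. Qed.

Lemma vopF_wedges v s : {in s, forall w, dotv v w = 0} ->
  vop false v (wedges s) = 0.
Proof.
elim: s => [|w s IHs] h; first exact: vopF1.
have := vop_anticomm false true v w (wedges s).
rewrite wedges_cons (h w) ?mem_head // IHs => [|x xs]; last first.
  by apply: h; rewrite inE xs orbT.
by rewrite vop0 addr0 mulr0 scale0r.
Qed.

Lemma wedges_mem v s : v \in s -> vop true v (wedges s) = 0.
Proof.
have half (M : multivector R n) : M + M = 0 -> M = 0.
  move=> M2; apply/ffunP => U; have := congr1 (fun K : multivector R n => K U) M2.
  by rewrite mvaddE ffunE => ?; lra.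
elim: s => // w s IHs; rewrite inE wedges_cons => /predU1P [->|/IHs vs].
  by apply: half; rewrite vop_anticomm eqxx mul0r scale0r.
have := vop_anticomm true true v w (wedges s).
by rewrite vs vop0 addr0 eqxx mul0r scale0r.
Qed.

Lemma mem_span_wedges s x : wedges s != 0 ->
  (x \in <<s>>%VS) = (wedge (vec x) (wedges s) == 0).
Proof.
move=> s0; rewrite wedge_vecE; apply/idP/eqP => [xs|x0].
  rewrite (@coord_span _ _ _ (in_tuple s) x xs) vopl_sum big1 // => i _.
  by rewrite wedges_mem ?scaler0 // mem_nth.
have [pU hp] := orthprojP <<s>>%VS x.
have a0 : vop false (x - orthproj <<s>>%VS x) (wedges s) = 0.
  by apply: vopF_wedges => w ws; apply/hp/memv_span.
have := vop_anticomm false true (x - orthproj <<s>>%VS x) x (wedges s).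
rewrite x0 a0 !vop0 addr0 mul1r => /esym/eqP.
rewrite scaler_eq0 (negPf s0) orbF => /eqP xx.
suff /eqP : x - orthproj <<s>>%VS x == 0 by move/subr0_eq => ->.
by rewrite -dotvv_eq0 dotvDr xx dotvNr hp // subrr.
Qed.

Lemma blade_spaceE s : wedges s != 0 -> blade_space (wedges s) = <<s>>%VS.
Proof.
move=> s0; rewrite /blade_space; set P := (X in xget _ X).
have sP : wedges s = wedges (xget [::] P) by exact: (@xgetPex _ [::] P (ex_intro P s erefl)).
by apply/vspaceP => x; rewrite !mem_span_wedges -?sP.
Qed.

Lemma wedges1 v : wedges [:: v] = vec v.
Proof. by have := vec_mulE v 1; rewrite mulr1 vopF1 addr0 wedges_cons => ->. Qed.

Lemma vec_mul v w : vec v * vec w = (dotv v w)%:A + wedge (vec v) (vec w).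
Proof.
rewrite vec_mulE wedge_vecE addrC; congr (_ + _).
have := vop_anticomm false true v w 1; rewrite vopF1 vop0 addr0 mul1r => <-.
by rewrite -[vec w]wedges1 wedges_cons.
Qed.

Definition orthonormal p (e : p.-tuple 'rV[R]_n) :=
  forall i j, dotv (tnth e i) (tnth e j) = (i == j)%:R.

Lemma prod_orthogonal (s : seq 'rV[R]_n) : pairwise (fun v w => dotv v w == 0) s ->
  \prod_(v <- s) vec v = wedges s.
Proof.
elim: s => [|v s IHs]; rewrite ?big_nil // big_cons /= => /andP [/allP vs /IHs ->].
by rewrite vec_mulE vopF_wedges ?addr0 ?wedge_vecE // => w /vs /eqP.
Qed.

Lemma prod_orthonormalK p (e : p.-tuple 'rV[R]_n) : orthonormal e ->
  (\prod_(v <- e) vec v) * (\prod_(v <- rev e) vec v) = 1 /\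
  (\prod_(v <- rev e) vec v) * (\prod_(v <- e) vec v) = 1.
Proof.
move=> oe.
have e1 v : v \in val e -> vec v * vec v = 1.
  move=> /tnthP [i ->]; rewrite vec_mul oe eqxx scale1r.
  by rewrite -[X in wedge _ X]wedges1 wedge_vecE wedges_mem ?addr0 ?mem_head.
case: e {oe} e1 => s /= _.
elim: s => [|v s IHs] e1; first by rewrite (_ : rev [::] = [::]) // !big_nil mulr1.
have [i1 i2] : _ /\ _ := IHs (fun w ws => e1 w (mem_behead (s := v :: s) ws)).
rewrite rev_cons -cats1 big_cat big_seq1 big_cons /=.
have vv := e1 v (mem_head _ _); split.
  by rewrite -mulrA [_ * (_ * vec v)]mulrA i1 mul1r.
by rewrite -mulrA [vec v * (_ * _)]mulrA vv mul1r.
Qed.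

End Blades.

Section PrincipalBivectors.
Variables (R : realType) (n p : nat).
Implicit Types (e f : p.-tuple 'rV[R]_n) (theta : 'I_p -> R).

Definition mvexp (M : multivector R n) : multivector R n :=
  limn (series (fun k => k`!%:R^-1 *: M ^+ k)).

Definition principal_bases (V W : {vspace 'rV[R]_n}) theta e f :=
  [/\ basis_of V e /\ orthonormal e,
      basis_of W f /\ orthonormal f,
      forall i, 0 <= theta i <= pi / 2,
      forall i j : 'I_p, (i <= j)%N -> theta i <= theta j &
      forall i j, dotv (tnth e i) (tnth f j) = (i == j)%:R * cos (theta i)].

(* Indices are 0-based below, so d is the first index with a nonzero angle. *)
Definition pbivector (d : nat) e f (i : 'I_p) : multivector R n :=
  let B := wedge (vec (tnth e i)) (vec (tnth f i)) in
  if (i < d)%N then 0 else `|B|^-1 *: B.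

Definition angle_bivector (d : nat) theta e f : multivector R n :=
  \sum_i theta i *: pbivector d e f i.

(* vecpart only changes the type here: I_i f_i is a vector by vec_eperp. *)
Definition eperp (d : nat) e f (i : 'I_p) : 'rV[R]_n :=
  vecpart (pbivector d e f i * vec (tnth f i)).

Lemma vec_eperp (d : nat) e f i : orthonormal f ->
  vec (eperp d e f i) = pbivector d e f i * vec (tnth f i).
Proof.
move=> of_; suff [v vE] : exists v, pbivector d e f i * vec (tnth f i) = vec v.
  by rewrite /eperp vE vecK.
rewrite /pbivector; case: ifP => _; first by exists 0; rewrite mul0r linear0.
set a := _^-1; have fE := vec_mul (tnth f i) (tnth f i).
have -> : wedge (vec (tnth e i)) (vec (tnth f i)) =
    vec (tnth e i) * vec (tnth f i) - (dotv (tnth e i) (tnth f i))%:A.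
  by rewrite vec_mul addrAC subrr add0r.
have ff : vec (tnth f i) * vec (tnth f i) = 1.
  rewrite vec_mul of_ eqxx scale1r -[X in wedge _ X]wedges1.
  by rewrite wedge_vecE wedges_mem ?addr0 ?mem_head.
exists (a *: (tnth e i - dotv (tnth e i) (tnth f i) *: tnth f i)).
rewrite -scalerAl mulrBl -mulrA ff mulr1 -scalerAl mul1r.
by rewrite vecZ vecB vecZ.
Qed.

Definition beta_sum (d : nat) e f : seq 'rV[R]_n :=
  take d f ++
  flatten [seq [:: eperp d e f i; tnth f i] | i : 'I_p <- enum 'I_p & (d <= i)%N].

Definition increasing m (j : p.-tuple 'I_m) : bool :=
  sorted ltn [seq val k | k <- j].

Definition coord_blade (d : nat) e f (j : p.-tuple 'I_(2 * p - d))
    : multivector R n :=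
  \prod_(k <- j) vec (beta_sum d e f)`_k.

(* Right multiplication by F^-1 for F = f_1 ... f_p, see prod_orthonormalK. *)
Definition sigma f (C : multivector R n) : multivector R n :=
  C * \prod_(v <- rev f) vec v.

End PrincipalBivectors.

(* Main.v *)
(* In the plane of e_i and f_i one has e_i f_i = cos theta_i + sin theta_i I_i,
   and the nonzero I_i commute and square to -1, so exp(Phi) is the product of the
   e_i f_i, which regroups as (e_1 ... e_p) (f_p ... f_1) = sigma (e_1 ... e_p).
   Expanding each e_i in the orthonormal basis (y_k) of V + W writes
   e_1 ... e_p as the sum of (prod_i e_i . y_(g i)) C_g over all maps g; the
   product vanishes unless y_(g i) lies in the plane of e_i and f_i for all i,
   which forces g to be increasing.  On the other hand, the projection factor
   of V on Y_g is the absolute value of det (e_i . y_(g j)); this matrix has at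
   most one nonzero entry in each column, in a row that is nondecreasing in j,
   so it is either diagonal or has a zero row, and in both cases its
   determinant is the product of its diagonal, which is nonnegative. *)

Require Import Defs.
From mathcomp Require Import boolp classical_sets.
From mathcomp Require Import all_boot all_order all_algebra.
From mathcomp Require Import ring zify.
From mathcomp Require Import reals topology normedtype sequences trigo.

Set Implicit Arguments.
Unset Strict Implicit.
Unset Printing Implicit Defensive.

Import Order.TTheory GRing.Theory Num.Theory numFieldNormedType.Exports.

Local Open Scope ring_scope.

(** * Exponentials of combinations of commuting square roots of -1 *)

Section Exponential.
Variables (R : realType) (n : nat).
Implicit Types (x : R) (J K M T : multivector R n).

(** Partial sums of e^M T. Keeping the factor [T] inside allows two exponents to be exchanged when
    they agree only on [T]. *)
Definition exp_apply M T : nat -> multivector R n :=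
  series (fun k => k`!%:R^-1 *: (M ^+ k * T)).

Lemma commrZ x J K : GRing.comm J K -> GRing.comm J (x *: K).
Proof. by move=> JK; rewrite /GRing.comm -scalerAr -scalerAl JK. Qed.

Lemma exp_applyD M T1 T2 L1 L2 :
  (exp_apply M T1 @ \oo --> L1)%classic -> (exp_apply M T2 @ \oo --> L2)%classic ->
  (exp_apply M (T1 + T2) @ \oo --> L1 + L2)%classic.
Proof.
move=> h1 h2.
have -> : exp_apply M (T1 + T2) = (exp_apply M T1 \+ exp_apply M T2)%R.
  apply/funext => m; rewrite /exp_apply /series /= -big_split /=.
  by apply: eq_bigr => k _; rewrite mulrDr scalerDr.
exact: cvgD.
Qed.

(** By induction on the power: commutation carries the remaining [M] past [K ^+ k] to [T], where it
    acts as [K]. *)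
Lemma eq_exp_apply M K T : GRing.comm M K -> M * T = K * T ->
  exp_apply M T = exp_apply K T.
Proof.
move=> MK MT; apply/funext => m; apply: eq_bigr => k _; congr (_ *: _).
elim: k => // k IHk.
by rewrite exprS -mulrA IHk mulrA (commrX k MK) -mulrA MT mulrA -exprSr.
Qed.

(** Even powers of [J] are the scalars 1 and -1 in alternation and odd powers have one extra [J], so
    they feed the cosine and the sine series. *)
Lemma exprZ_sqrN1 x J k : J * J = -1 ->
  k`!%:R^-1 *: (x *: J) ^+ k = cos_coeff x k *: 1 + sin_coeff x k *: J.
Proof.
move=> JJ; rewrite exprZn scalerA.
have J2 m : J ^+ m.*2 = (-1) ^+ m *: 1.
  elim: m => [|m IHm]; first by rewrite scale1r.
  by rewrite doubleS !exprS mulrA JJ IHm !mulN1r scaleNr.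
have [m [b ->]] : exists m (b : bool), k = (b + m.*2)%N.
  by exists k./2, (odd k); rewrite odd_double_half.
case: b; rewrite ?add1n ?add0n.
  rewrite cos_coeff_odd -sin_coeff'E scale0r add0r (exprS J) J2 -scalerAr mulr1 scalerA.
  congr (_ *: _); rewrite /sin_coeff' -exprnP; ring.
rewrite sin_coeff_even -cos_coeff'E scale0r addr0 J2 scalerA.
by congr (_ *: _); rewrite /cos_coeff' -exprnP; ring.
Qed.

Lemma cvg_exp_sqrN1 x J T : J * J = -1 ->
  (exp_apply (x *: J) T @ \oo --> (cos x *: 1 + sin x *: J) * T)%classic.
Proof.
move=> JJ.
have -> : exp_apply (x *: J) T = (fun m => series (cos_coeff x) m *: T) \+
    (fun m => series (sin_coeff x) m *: (J * T)).
  apply/funext => m; rewrite /exp_apply /series /= !scaler_suml -big_split /=.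
  apply: eq_bigr => k _.
  by rewrite scalerAl exprZ_sqrN1 // mulrDl -!scalerAl mul1r.
rewrite mulrDl -!scalerAl mul1r; apply: cvgD; apply: cvgZl.
  rewrite cos.unlock; exact: is_cvg_series_cos_coeff.
rewrite sin.unlock; exact: is_cvg_series_sin_coeff.
Qed.

(* The multivectors P = (1 - J K) / 2 and 1 - P = (1 + J K) / 2 satisfy
   K P = J P and K (1 - P) = - J (1 - P), so that on each of the two summands
   of T = P T + (1 - P) T the term theta K merges into x J. *)
Lemma cvg_exp_comm_sqrN1 J (l : seq (R * multivector R n)) x T :
  J * J = -1 -> {in l, forall a, a.2 * a.2 = -1} ->
  {in l, forall a, GRing.comm a.2 J} ->
  {in l &, forall a b, GRing.comm a.2 b.2} ->
  (exp_apply (x *: J + \sum_(a <- l) a.1 *: a.2) T @ \oo -->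
    (cos x *: 1 + sin x *: J) * \prod_(a <- l) (cos a.1 *: 1 + sin a.1 *: a.2) * T)%classic.
Proof.
move=> JJ; elim: l x T => [|[t K] l IHl] x T sq cJ cc.
  by rewrite !big_nil addr0 mulr1; exact: cvg_exp_sqrN1.
have KK : K * K = -1 by exact: (sq _ (mem_head _ _)).
have KJ : K * J = J * K by exact: (cJ _ (mem_head _ _)).
have sl a : a \in l -> a \in (t, K) :: l by rewrite inE => ->; rewrite orbT.
have {}IHl y U := IHl y U (fun a al => sq a (sl a al)) (fun a al => cJ a (sl a al))
  (fun a b al bl => cc a b (sl a al) (sl b bl)).
set E := \prod_(a <- l) _ in IHl *.
set S := \sum_(a <- l) _ in IHl *.
have cS M : {in l, forall a, GRing.comm M a.2} -> GRing.comm M S /\ GRing.comm M E.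
  move=> Ml; rewrite /S /E !big_seq; split.
    by apply: commr_sum => a al; apply: commrZ (Ml a al).
  apply: commr_prod => a al; apply: commrD; apply: commrZ; first exact: commr1.
  exact: Ml.
have [JS JE] : GRing.comm J S /\ GRing.comm J E.
  by apply: cS => a al; apply/commr_sym/cJ/sl.
have [KS KE] : GRing.comm K S /\ GRing.comm K E.
  by apply: cS => a al; apply: (cc (t, K) a); rewrite ?mem_head ?sl.
(* Where [t *: K] acts as [y *: J], it is absorbed into the coefficient of [J], leaving an exponent
   covered by the induction hypothesis. *)
have merge y U : t *: (K * U) = y *: (J * U) ->
    exp_apply (x *: J + (t *: K + S)) U = exp_apply ((x + y) *: J + S) U.
  move=> tU; apply: eq_exp_apply; last first.
    by rewrite !mulrDl scalerDl -!scalerAl mulrDl -!scalerAl tU addrA.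
  have [XJ XS] : GRing.comm J (x *: J + (t *: K + S)) /\
      GRing.comm S (x *: J + (t *: K + S)).
    have [SJ SK] := (commr_sym JS, commr_sym KS).
    by split; (apply: commrD; [|apply: commrD]) => //; apply: commrZ => //; exact: commr_sym KJ.
  by apply: commrD; [apply: commrZ|]; exact: commr_sym.
(* The halves of [T - D] and [T + D] are the components [P T] and [(1 - P) T]. *)
pose D := J * (K * T).
have TE : T = 2^-1 *: (T - D) + 2^-1 *: (T + D).
  by apply/ffunP => A; rewrite !(mvaddE, mvscaleE) !ffunE; field.
rewrite !big_cons /=.
(* The right side adds the limits that induction gives at [x + t] and [x - t]; the angle addition
   formulas identify it with the product. *)
suff -> : (cos x *: 1 + sin x *: J) * ((cos t *: 1 + sin t *: K) * E) * T =
  (cos (x + t) *: 1 + sin (x + t) *: J) * E * (2^-1 *: (T - D)) +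
  (cos (x - t) *: 1 + sin (x - t) *: J) * E * (2^-1 *: (T + D)).
  rewrite [in exp_apply _ T]TE; apply: exp_applyD.
    rewrite (merge t); first exact: IHl.
    rewrite -!scalerAr !mulrBr; congr (_ *: (_ *: _)).
    rewrite /D !mulrA KJ -!mulrA !(mulrA K K) !(mulrA J J) KK JJ !mulN1r mulrN.
    by rewrite !opprK addrC.
  rewrite (merge (- t)); first exact: IHl.
  rewrite scaleNr -scalerN -!scalerAr !mulrDr; congr (_ *: _).
  rewrite -scalerN; congr (_ *: _).
  rewrite /D !mulrA KJ -!mulrA !(mulrA K K) !(mulrA J J) KK JJ !mulN1r mulrN.
  by rewrite opprD opprK addrC.
have ED : E * D = J * (K * (E * T)).
  by rewrite /D (mulrA E J) -JE -mulrA (mulrA E K) -KE -!mulrA.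
rewrite -!mulrA -!scalerAr !(mulrBr, mulrDr) ED; set U := E * T.
have JJKU : J * (J * (K * U)) = - (K * U) by rewrite mulrA JJ mulN1r.
rewrite !mulrDl -!scalerAl !mul1r !mulrDr -!scalerAr JJKU cosD sinD cosB sinB.
by apply/ffunP => A; rewrite !(mvaddE, mvscaleE, ffunE); field.
Qed.

Lemma mvexp_comm_sqrN1 (l : seq (R * multivector R n)) :
  {in l, forall a, a.2 * a.2 = -1} -> {in l &, forall a b, GRing.comm a.2 b.2} ->
  mvexp (\sum_(a <- l) a.1 *: a.2) = \prod_(a <- l) (cos a.1 *: 1 + sin a.1 *: a.2).
Proof.
move=> sq cc; have limE M L : (exp_apply M 1 @ \oo --> L)%classic -> mvexp M = L.
  move=> ML; rewrite -(cvg_lim _ ML); last exact: norm_hausdorff.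
  by congr (limn (series _)); apply/funext => k; rewrite mulr1.
(* A member of [l], added with coefficient 0, serves as the distinguished root [J]; the empty list
   has none and is treated apart. *)
apply: limE; have [->|[J [Jl ->]]] : l = [::] \/ exists J : R * multivector R n, J \in l /\
    \sum_(a <- l) a.1 *: a.2 = 0 *: J.2 + \sum_(a <- l) a.1 *: a.2.
- case: l {sq cc} => [|J l]; [by left | right].
  by exists J; rewrite mem_head scale0r add0r.
(* The partial sum at index 0 is empty; from index 1 on the sums are constantly 1, hence the
   shift. *)
- rewrite !big_nil -(cvg_shiftS (exp_apply 0 1)) /=.
  rewrite (_ : (fun m => _) = fun=> 1); first exact: cvg_cst.
  apply/funext => m; rewrite /exp_apply /series /= big_nat_recl // big1 => [|k _].
    by rewrite mulr1 invr1 scale1r addr0.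
  by rewrite expr0n mul0r scaler0.
have := @cvg_exp_comm_sqrN1 J.2 l 0 1 (sq _ Jl) sq (fun a al => cc a J al Jl) cc.
by rewrite cos0 sin0 scale1r scale0r addr0 mul1r mulr1.
Qed.

End Exponential.

(** * Products of vectors and their norms *)

Section Clifford.
Variables (R : realType) (n : nat).
Implicit Types (u v w : 'rV[R]_n) (M K : multivector R n).

Lemma vec_sqr v : vec v * vec v = (dotv v v)%:A.
Proof.
by rewrite vec_mul -[X in wedge _ X]wedges1 wedge_vecE wedges_mem ?addr0 ?mem_head.
Qed.

(** Each factor splits into its grade-raising and grade-lowering operator; by [vop_anticomm] only
    the two mixed pairs survive, each giving [dotv u v]. *)
Lemma vec_mulD u v : vec u * vec v + vec v * vec u = (2 * dotv u v)%:A.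
Proof.
have E x y : vec x * vec y = \sum_(b : bool) \sum_(c : bool) vop b x (vop c y 1).
  by rewrite -[vec y]mulr1 !vec_mulE !big_bool /= !vopD addrACA.
rewrite !E [X in _ + X]exchange_big -big_split /=.
under eq_bigr => b _.
  rewrite -big_split /=; under eq_bigr => c _ do rewrite vop_anticomm.
  over.
by rewrite !big_bool /= !mul0r !scale0r mul1r addr0 add0r -scalerDl mulr_natl mulr2n.
Qed.

Lemma vec_anticomm u v : dotv u v = 0 -> vec u * vec v = - (vec v * vec u).
Proof.
by move=> uv; apply/eqP; rewrite -addr_eq0 vec_mulD uv mulr0 scale0r.
Qed.

(** A basis vector permutes the x_U up to sign through the involution [symdiff [set i]], and the
    sign is the same in both directions. *)
Lemma mvdot_vecM v M K : mvdot (vec v * M) K = mvdot M (vec v * K).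
Proof.
have E (A B : multivector R n) : mvdot (vec v * A) B = \sum_i v 0 i *
    \sum_U reorder_sign R [set i] (symdiff [set i] U) * A (symdiff [set i] U) * B U.
  rewrite /mvdot; under eq_bigr => U _.
    rewrite mvmulE; under eq_bigr => S _ do rewrite (mulrC (reorder_sign _ _ _)) -mulrA.
    rewrite (sum_vecE (fun S => reorder_sign R S (symdiff S U) * A (symdiff S U))) mulr_suml.
    over.
  rewrite exchange_big; apply: eq_bigr => i _ /=; rewrite mulr_sumr.
  by apply: eq_bigr => U _; rewrite !mulrA.
rewrite E /mvdot; under [RHS]eq_bigr => U _ do rewrite mulrC.
rewrite -/(mvdot (vec v * K) M) E; apply: eq_bigr => i _; congr (_ * _).
rewrite (reindex_inj (can_inj (symdiffK [set i]))) /=; apply: eq_bigr => U _.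
have -> : reorder_sign R [set i] (symdiff [set i] U) = reorder_sign R [set i] U.
  by rewrite reorder_signDr reorder_sign11 ltnn mul1r.
by rewrite symdiffK mulrAC.
Qed.

(** Self-adjointness brings each vector next to its own copy, where the pair becomes a scalar. *)
Lemma mvnorm_vec_vec u v : `|vec u * vec v| = Num.sqrt (dotv u u * dotv v v).
Proof.
rewrite mvnormE /mvnorm mvdot_vecM mulrA vec_sqr -scalerAl mul1r.
rewrite -{1}[vec v]mulr1 mvdot_vecM -scalerAr vec_sqr scalerA; congr Num.sqrt.
rewrite /mvdot (bigD1 set0) //= big1 => [|S /negPf S0].
  by rewrite mvscaleE !ffunE eqxx mulr1 mul1r addr0.
by rewrite ffunE S0 mul0r.
Qed.

End Clifford.

(** * Staircase determinants and expansion of products of sums *)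

Lemma det_staircase (R : comNzRingType) p (A : 'M[R]_p) (b : 'I_p -> 'I_p) :
  {homo b : i j / (i <= j)%N} -> (forall i j, b j != i -> A i j = 0) ->
  \det A = \prod_i A i i.
Proof.
move=> b_homo A0; have [/injectiveP b_inj | /injectiveP b_inj] := boolP (injectiveb b).
  (* A strictly increasing [b] satisfies [k <= b k], so all entries above the diagonal vanish. *)
  have b_ge k (kp : (k < p)%N) : (k <= b (Ordinal kp))%N.
    elim: k kp => // k IHk kp; apply: leq_ltn_trans (IHk (ltnW kp)) _.
    rewrite ltn_neqAle b_homo /= ?leqnSn // andbT.
    by apply/eqP => /val_inj /b_inj [/eqP]; rewrite ltn_eqF.
  apply: det_trig; apply/is_trig_mxP => i j ij; apply: A0.
  apply: contraTneq ij => <-; rewrite -leqNgt.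
  by case: j => j jp; exact: b_ge.
(* On a finite set, failing to be injective means missing some [i]; row [i] is then zero, including
   its diagonal entry. *)
have [i iNb] : exists i, i \notin codom b.
  apply/existsP; apply: contra_notT b_inj; rewrite negb_exists => /forallP b_onto.
  apply/injectiveP/card_uniqP; rewrite size_codom.
  by apply: eq_card => i; rewrite !inE -[LHS]negbK b_onto.
have row0 j : A i j = 0.
  by apply: A0; apply: contraNneq iNb => <-; exact: codom_f.
rewrite (expand_det_row _ i) big1 => [|j _]; last by rewrite row0 mul0r.
by rewrite (bigD1 i) //= row0 mul0r.
Qed.

(** Distributivity, with choice functions recoded as tuples: the scalars commute, while the factors
    [y k] must stay in order. *)
Lemma prod_sum_tuple (K : comNzRingType) (A : algType K) p m
    (c : 'I_p -> 'I_m -> K) (y : 'I_m -> A) :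
  \prod_i \sum_k c i k *: y k =
    \sum_(g : p.-tuple 'I_m) (\prod_i c i (tnth g i)) *: \prod_(k <- g) y k.
Proof.
rewrite bigA_distr_bigA /=.
rewrite (reindex (fun g : p.-tuple 'I_m => [ffun i => tnth g i])) /=; last first.
  exists (fun g : {ffun 'I_p -> 'I_m} => [tuple g i | i < p]) => g _.
    by apply: eq_from_tnth => i; rewrite tnth_mktuple ffunE.
  by apply/ffunP => i; rewrite ffunE tnth_mktuple.
apply: eq_bigr => g _; rewrite big_tuple -scaler_prod.
by apply: eq_bigr => i _; rewrite ffunE.
Qed.

(** * Projections, blades and projection factors in orthonormal bases *)

Section Orthonormal.
Variables (R : realType) (n : nat).
Implicit Types (u v w x : 'rV[R]_n) (V : {vspace 'rV[R]_n}).

Lemma dotv_sum_orthonormal m (y : m.-tuple 'rV[R]_n) (a : 'I_m -> R) k :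
  Defs.orthonormal y -> dotv (\sum_i a i *: tnth y i) (tnth y k) = a k.
Proof.
move=> oy; rewrite dotv_suml (bigD1 k) //= big1 => [|i /negPf ik].
  by rewrite dotvZl oy eqxx mulr1 addr0.
by rewrite dotvZl oy ik mulr0.
Qed.

Lemma orthproj_orthonormal m (y : m.-tuple 'rV[R]_n) x : Defs.orthonormal y ->
  orthproj <<y>> x = \sum_k dotv x (tnth y k) *: tnth y k.
Proof.
move=> oy; apply: orthproj_uniq => [|w].
  by apply: memv_suml => k _; apply/memvZ/memv_span/mem_tnth.
apply: dotv_orth_span => v /tnthP [k ->].
by rewrite dotvDl dotvNl dotv_sum_orthonormal // subrr.
Qed.

Lemma span_orthonormalE m (y : m.-tuple 'rV[R]_n) x : Defs.orthonormal y ->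
  x \in <<y>>%VS -> x = \sum_k dotv x (tnth y k) *: tnth y k.
Proof.
move=> oy xy; rewrite -orthproj_orthonormal //; apply/esym/orthproj_uniq => // w _.
by rewrite subrr dotv0l.
Qed.

Lemma orthonormal_pairwise m (y : m.-tuple 'rV[R]_n) : Defs.orthonormal y ->
  pairwise (fun v w => dotv v w == 0) y.
Proof.
move=> oy; apply/(pairwiseP 0) => i j; rewrite !inE !size_tuple => im jm ij.
rewrite -(tnth_nth _ _ (Ordinal im)) -(tnth_nth _ _ (Ordinal jm)) oy.
by rewrite -val_eqE /= (ltn_eqF ij).
Qed.

Lemma blade_space_orthonormal m (y : m.-tuple 'rV[R]_n) : Defs.orthonormal y ->
  blade_space (\prod_(v <- y) vec v) = <<y>>%VS.
Proof.
(* The reversed product is an inverse, so the blade is nonzero. *)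
move=> oy; have y0 : \prod_(v <- y) vec v != 0.
  apply/eqP => y0; have [] := prod_orthonormalK oy; rewrite y0 mul0r => /eqP.
  by rewrite eq_sym oner_eq0.
have yE := prod_orthogonal (orthonormal_pairwise oy).
by rewrite yE blade_spaceE // -yE.
Qed.

Lemma gram_orthonormal m (y : m.-tuple 'rV[R]_n) : Defs.orthonormal y -> gram y = 1%:M.
Proof. by move=> oy; apply/matrixP => i j; rewrite !mxE oy. Qed.

(** The projected [e] has coordinate matrix [A] in the basis [y], hence Gram matrix [A *m A^T] and
    volume the root of [\det A ^+ 2]. *)
Lemma proj_factor_orthonormal p V (e y : p.-tuple 'rV[R]_n) :
  basis_of V e -> Defs.orthonormal e -> Defs.orthonormal y ->
  proj_factor V <<y>> = `|\det (\matrix_(i, j) dotv (tnth e i) (tnth y j))|.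
Proof.
move=> eV oe oy; set A := \matrix_(i, j) _.
have dV : \dim V = p by rewrite -(size_basis eV).
rewrite (proj_factorE _ dV eV) /pvol (gram_orthonormal oe) det1 sqrtr1 divr1.
rewrite (gram_comb (t := y) (A := A)) => [|i].
  by rewrite gram_orthonormal // mulmx1 det_mulmx det_tr -expr2 sqrtr_sqr.
rewrite tnth_map orthproj_orthonormal //; apply: eq_bigr => j _.
by rewrite mxE.
Qed.

End Orthonormal.

(** * Positions of vectors in the basis of V + W *)

Section BetaSum.
Variable d : nat.

(* y_k lies in the plane of e_i and f_i for i = pair_index k, and it is f_i
   rather than e_i^perp exactly when is_f k. *)
Definition pair_index (k : nat) : nat := if (k < d)%N then k else (d + (k - d)./2)%N.

Definition is_f (k : nat) : bool := (k < d)%N || odd (k - d).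

Lemma pair_index_mono k l : (k <= l)%N -> (pair_index k <= pair_index l)%N.
Proof. by rewrite /pair_index; case: (ltnP k d); case: (ltnP l d); lia. Qed.

Lemma pair_index_inj k l : is_f k = is_f l -> pair_index k = pair_index l -> k = l.
Proof. rewrite /is_f /pair_index; case: (ltnP k d) => kd; case: (ltnP l d) => ld /=; lia. Qed.

Lemma is_fN_ge k : ~~ is_f k -> (d <= pair_index k)%N.
Proof. rewrite /is_f /pair_index; case: (ltnP k d) => //=; lia. Qed.

Variables (R : realType) (n p : nat) (e f : p.-tuple 'rV[R]_n).
Hypothesis dp : (d <= p)%N.

Lemma pair_index_lt (k : 'I_(2 * p - d)) : (pair_index k < p)%N.
Proof. move: (ltn_ord k); rewrite /pair_index; case: (ltnP k d); lia. Qed.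

Definition pair_ord (k : 'I_(2 * p - d)) : 'I_p := Ordinal (pair_index_lt k).

Lemma nth_flatten_pairs (A I : Type) (x0 : A) (i0 : I) (a b : I -> A) (s : seq I) k :
  (k < 2 * size s)%N -> nth x0 (flatten [seq [:: a i; b i] | i <- s]) k =
    (if odd k then b else a) (nth i0 s k./2).
Proof.
elim: s k => [|i s IHs] [|[|k]] //= ks; rewrite IHs ?negbK //; move: ks => /=; lia.
Qed.

Lemma nth_beta_sum (k : 'I_(2 * p - d)) :
  (beta_sum d e f)`_k = if is_f k then tnth f (pair_ord k) else eperp d e f (pair_ord k).
Proof.
(* The pairs have indices d, ..., p - 1, so beyond the first [d] entries position [k] belongs to
   pair [d + (k - d)./2]. *)
have sE : [seq nat_of_ord i | i : 'I_p <- enum 'I_p & (d <= i)%N] = iota d (p - d).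
  rewrite -(filter_map (@nat_of_ord p) (leq d)) val_enum_ord -{1}(subnKC dp) iotaD filter_cat add0n.
  rewrite (@eq_in_filter _ (leq d) pred0) => [|i]; last first.
    by rewrite mem_iota /= add0n ltnNge => /negbTE ->.
  rewrite filter_pred0 (@eq_in_filter _ (leq d) predT) ?filter_predT // => i.
  by rewrite mem_iota => /andP [].
have szs := congr1 size sE; rewrite size_map size_iota in szs.
rewrite /beta_sum nth_cat size_takel ?size_tuple // /is_f.
case: ltnP => kd /=.
  by rewrite nth_take // (tnth_nth 0) /= /pair_index kd.
have kp := ltn_ord k; have kd2 : ((k - d)./2 < p - d)%N by lia.
rewrite (nth_flatten_pairs _ (pair_ord k)) ?szs; last by lia.
set i := nth _ _ _; have -> : i = pair_ord k; last by case: ifP.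
apply: val_inj; rewrite /i -(nth_map _ 0%N) ?szs // sE nth_iota //=.
by rewrite /pair_index ltnNge kd.
Qed.

End BetaSum.

(** * Increasing tuples and reordering of products *)

Lemma increasing_ltn p m (g : p.-tuple 'I_m) (i j : 'I_p) :
  increasing g -> (i < j)%N -> (tnth g i < tnth g j)%N.
Proof.
move=> /(sorted_ltn_nth ltn_trans 0%N) g_incr ij; have m_gt0 := ltn_ord (tnth g i).
have:= g_incr i j; rewrite !inE size_map size_tuple !ltn_ord => /(_ isT isT ij).
by rewrite !(nth_map (tnth g i)) ?size_tuple ?ltn_ord // -!tnth_nth.
Qed.

Lemma ltn_increasing p m (g : p.-tuple 'I_m) :
  (forall i j : 'I_p, (i < j)%N -> (tnth g i < tnth g j)%N) -> increasing g.
Proof.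
case: m g => [|m] g g_incr.
  by case: p g {g_incr} => [|p] g; [rewrite tuple0 | case: (tnth g ord0)].
rewrite /increasing sorted_map; apply/(sortedP ord0) => i; rewrite size_tuple => ip.
rewrite /= -(tnth_nth _ _ (Ordinal ip)) -(tnth_nth _ _ (Ordinal (ltnW ip))).
exact: g_incr.
Qed.

(** Each [b i] moves right past all later pairs [a j * b j], so the first one ends up last. *)
Lemma prod_mul_rev (A : nzRingType) (I : eqType) (a b : I -> A) (s : seq I) : uniq s ->
  {in s &, forall i j, i != j -> GRing.comm (b i) (a j * b j)} ->
  \prod_(i <- s) (a i * b i) = \prod_(i <- s) a i * \prod_(i <- rev s) b i.
Proof.
elim: s => [|i s IHs] /=; first by rewrite !big_nil mulr1.
move=> /andP [is_ us] h; have hs := sub_in2 (@mem_behead _ (i :: s)) h.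
rewrite rev_cons -cats1 big_cat big_seq1 !big_cons -[RHS]mulrA (mulrA _ _ (b i)) -IHs //.
rewrite -mulrA; congr (_ * _); rewrite big_seq; apply: commr_prod => j js.
apply: h; rewrite ?inE ?eqxx ?js ?orbT //.
by apply: contraNneq is_ => ->.
Qed.

(** * Metric relations between the principal bases *)

Section Principal.
Variables (R : realType) (n p : nat) (V W : {vspace 'rV[R]_n}).
Variables (theta : 'I_p -> R) (e f : p.-tuple 'rV[R]_n).
Hypothesis hef : principal_bases V W theta e f.
Let d : nat := \dim (V :&: W)%VS.

Lemma cos_principal_ge0 i : 0 <= cos (theta i).
Proof.
have [_ _ /(_ i) /andP [t0 t1] _ _] := hef; apply: cos_ge0_pihalf.
by rewrite t1 (le_trans _ t0) // oppr_le0 divr_ge0 ?pi_ge0.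
Qed.

Lemma sin_principal_ge0 i : 0 <= sin (theta i).
Proof.
have [_ _ /(_ i) /andP [t0 t1] _ _] := hef; apply: sin_ge0_pi.
by rewrite t0 (le_trans t1) // ler_pdivrMr // ler_peMr ?pi_ge0 // ler1n.
Qed.

Lemma sin_principal_eq0 i : (sin (theta i) == 0) = (theta i == 0).
Proof.
have [_ _ /(_ i) /andP [t0 t1] _ _] := hef; apply/eqP/eqP => [s0|->]; last exact: sin0.
apply/eqP; rewrite eq_le t0 andbT leNgt; apply/negP => t_gt0.
have : 0 < sin (theta i).
  apply: sin_gt0_pi; rewrite t_gt0 (le_lt_trans t1) //.
  by rewrite ltr_pdivrMr // ltr_pMr ?pi_gt0 // ltr1n.
by rewrite s0 ltxx.
Qed.

Lemma dotv_ef i j : dotv (tnth e i) (tnth f j) = (i == j)%:R * cos (theta i).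
Proof. by case: hef. Qed.

Lemma dotv_ee i j : dotv (tnth e i) (tnth e j) = (i == j)%:R.
Proof. by case: hef => -[]. Qed.

Lemma dotv_ff i j : dotv (tnth f i) (tnth f j) = (i == j)%:R.
Proof. by case: hef => _ -[]. Qed.

Lemma eq_principal i : theta i = 0 -> tnth e i = tnth f i.
Proof.
move=> t0; apply/eqP; rewrite -subr_eq0 -dotvv_eq0.
rewrite dotvDl !dotvDr !dotvNl !dotvNr opprK dotv_ee dotv_ff (dotvC (tnth f i)).
by rewrite dotv_ef t0 cos0 eqxx mulr1 subrr addNr addr0.
Qed.

(** The angles are sorted, so the zero ones come first, and the [f] at zero angles form a basis of
    the intersection. *)
Lemma ltn_dim_cap (i : 'I_p) : (i < d)%N = (theta i == 0).
Proof.
have [[eV oe] [fW of_] _ tm _] := hef.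
(* The position of the first nonzero angle, or [p] if there is none. *)
pose q := find (fun i => theta i != 0) (enum 'I_p).
have qp : (q <= p)%N by rewrite -[X in (_ <= X)%N](size_enum_ord p) find_size.
have tq (j : 'I_p) : (j < q)%N = (theta j == 0).
  apply/idP/eqP => [jq|t0].
    by have /negbFE /eqP := before_find j jq; rewrite nth_ord_enum.
  rewrite ltnNge; apply/negP => qj.
  have hq : has (fun i => theta i != 0) (enum 'I_p).
    by rewrite has_find size_enum_ord (leq_ltn_trans qj).
  have := nth_find j hq; rewrite -/q.
  set m := nth _ _ _ => /negP; apply.
  have mj : (m <= j)%N by rewrite /m nth_enum_ord // (leq_ltn_trans qj).
  by rewrite eq_le -{1}t0 tm //; have [_ _ /(_ m) /andP [] ] := hef.
suff -> : d = q by [].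
have -> : d = \dim <<take q f>>%VS.
  congr (\dim _); apply/eqP; rewrite eqEsubv; apply/andP; split; last first.
    apply/span_subvP => v /(nthP 0) [k]; rewrite size_takel ?size_tuple // => kq <-.
    have kp := leq_trans kq qp; rewrite nth_take // -(tnth_nth _ _ (Ordinal kp)) memv_cap.
    rewrite (basis_mem fW) ?mem_tnth // -eq_principal ?(basis_mem eV) ?mem_tnth //.
    by apply/eqP; rewrite -tq.
  apply/subvP => x /memv_capP [xV xW].
  have xe : x = \sum_k dotv x (tnth e k) *: tnth e k.
    by apply: span_orthonormalE => //; rewrite (span_basis eV).
  have xf : x = \sum_k dotv x (tnth f k) *: tnth f k.
    by apply: span_orthonormalE => //; rewrite (span_basis fW).
  have h1 k : dotv x (tnth f k) = dotv x (tnth e k) * cos (theta k).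
    rewrite {1}xe dotv_suml (bigD1 k) //= big1 => [|j /negPf jk].
      by rewrite dotvZl dotv_ef eqxx mul1r addr0.
    by rewrite dotvZl dotv_ef jk mul0r mulr0.
  have h2 k : dotv x (tnth e k) = dotv x (tnth f k) * cos (theta k).
    rewrite {1}xf dotv_suml (bigD1 k) //= big1 => [|j /negPf jk].
      by rewrite dotvZl (dotvC (tnth f _)) dotv_ef eqxx mul1r addr0.
    by rewrite dotvZl (dotvC (tnth f _)) dotv_ef eq_sym jk mul0r mulr0.
  rewrite xf; apply: memv_suml => k _; have [kq|kq] := boolP (k < q)%N.
    apply/memvZ/memv_span.
    by rewrite (tnth_nth 0) -(nth_take _ kq) mem_nth // size_takel ?size_tuple.
  suff -> : dotv x (tnth f k) = 0 by rewrite scale0r mem0v.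
  (* Passing from [f] to [e] and back multiplies the coordinate by the squared cosine, so the
     squared sine annihilates it. *)
  apply/eqP; move: kq; rewrite tq -sin_principal_eq0 => sk; have := h1 k.
  rewrite h2 -mulrA -expr2 cos2sin2 mulrBr mulr1 => /eqP.
  by rewrite eq_sym -subr_eq0 addrAC subrr add0r oppr_eq0 mulf_eq0 sqrf_eq0 (negPf sk) orbF.
have : free f := basis_free fW.
rewrite -{1}(cat_take_drop q f) => /catl_free; rewrite /free => /eqP ->.
by rewrite size_takel // size_tuple.
Qed.


Lemma dim_cap_le : (d <= p)%N.
Proof.
have [[eV _] _ _ _ _] := hef.
by apply: leq_trans (dimvS (capvSl V W)) _; rewrite -(size_basis eV).
Qed.

Lemma orthonormal_principal : Defs.orthonormal e /\ Defs.orthonormal f.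
Proof. by case: hef => -[_ oe] [_ of_]. Qed.

Local Notation ep := (eperp d e f).

(** The bivector of e_i and f_i is [vec u * vec (tnth f i)] with [u] orthogonal to f_i, and its norm
    is the sine. Multiplying by the sine undoes the normalization and includes zero angles. *)
Lemma sin_pbivector i :
  sin (theta i) *: pbivector d e f i = vec (tnth e i - cos (theta i) *: tnth f i) * vec (tnth f i).
Proof.
set u := _ - _.
have ff : vec (tnth f i) * vec (tnth f i) = 1 by rewrite vec_sqr dotv_ff eqxx scale1r.
rewrite /pbivector ltn_dim_cap; case: eqP => [t0|/eqP].
  by rewrite scaler0 /u t0 cos0 scale1r eq_principal // subrr linear0 mul0r.
rewrite -sin_principal_eq0 => s0.
have -> : wedge (vec (tnth e i)) (vec (tnth f i)) = vec u * vec (tnth f i).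
  have := vec_mul (tnth e i) (tnth f i); rewrite dotv_ef eqxx mul1r => efE.
  rewrite /u linearB linearZ mulrBl -scalerAl ff efE addrAC.
  by rewrite subrr add0r.
rewrite mvnorm_vec_vec.
have -> : dotv u u * dotv (tnth f i) (tnth f i) = sin (theta i) ^+ 2.
  rewrite /u dotvDl !dotvDr !dotvNl !dotvNr !dotvZl !dotvZr.
  rewrite (dotvC (tnth f i) (tnth e i)).
  by rewrite dotv_ee dotv_ff dotv_ef eqxx /= sin2cos2; ring.
by rewrite sqrtr_sqr ger0_norm ?sin_principal_ge0 // scalerA divff ?scale1r.
Qed.

Lemma sin_eperp i : sin (theta i) *: ep i = tnth e i - cos (theta i) *: tnth f i.
Proof.
have [oe of_] := orthonormal_principal; apply: (can_inj (@vecK R n)).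
rewrite vecZ vec_eperp // scalerAl sin_pbivector -mulrA vec_sqr dotv_ff eqxx.
by rewrite scale1r mulr1.
Qed.

Lemma principal_decomp i : tnth e i = cos (theta i) *: tnth f i + sin (theta i) *: ep i.
Proof. by rewrite sin_eperp addrC subrK. Qed.

Lemma pbivectorE i : pbivector d e f i = vec (ep i) * vec (tnth f i).
Proof.
have [oe of_] := orthonormal_principal.
by rewrite vec_eperp // -mulrA vec_sqr dotv_ff eqxx scale1r mulr1.
Qed.

Lemma sin_neq0 (i : 'I_p) : (d <= i)%N -> sin (theta i) != 0.
Proof. by rewrite leqNgt ltn_dim_cap sin_principal_eq0. Qed.

Lemma dotv_eperp_f (i j : 'I_p) : (d <= i)%N -> dotv (ep i) (tnth f j) = 0.
Proof.
move=> /sin_neq0 s0; apply: (mulfI s0); rewrite -dotvZl sin_eperp mulr0.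
rewrite dotvDl dotvNl dotvZl dotv_ef dotv_ff; ring.
Qed.

Lemma dotv_eperp (i j : 'I_p) : (d <= i)%N -> (d <= j)%N -> dotv (ep i) (ep j) = (i == j)%:R.
Proof.
move=> di dj; apply: (mulfI (sin_neq0 di)); apply: (mulfI (sin_neq0 dj)).
rewrite -dotvZl -dotvZr (sin_eperp j) dotvDr dotvNr dotvZr !dotvZl dotv_eperp_f // !mulr0.
rewrite oppr0 addr0 -dotvZl sin_eperp dotvDl dotvNl dotvZl (dotvC (tnth f i)) !dotv_ef dotv_ee.
rewrite (eq_sym j); case: eqP => [<-|_]; last by rewrite !(mul0r, mulr0) subrr.
by rewrite !mul1r mulr1 -!expr2 sin2cos2.
Qed.

Lemma dotv_e_eperp (i j : 'I_p) : (d <= j)%N ->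
  dotv (tnth e i) (ep j) = (i == j)%:R * sin (theta i).
Proof.
move=> dj; rewrite principal_decomp dotvDl !dotvZl (dotvC (tnth f i)) dotv_eperp_f //.
have [di|di] := leqP d i; first by rewrite dotv_eperp // mulr0 add0r mulrC.
(* For [i < d] the vector [ep i] is not a unit vector, but its coefficient vanishes. *)
rewrite (_ : sin _ = 0) ?mul0r ?mulr0 ?addr0 //.
by apply/eqP; rewrite sin_principal_eq0 -ltn_dim_cap.
Qed.

(** * The exponential of the angle bivector as a product *)

Lemma mvexp_angle_bivector :
  mvexp (angle_bivector d theta e f) =
    \prod_(v <- e) vec v * \prod_(v <- rev f) vec v.
Proof.
(* Only indices from [d] on are kept, as the zero bivectors do not square to -1. *)
pose l := [seq (theta i, pbivector d e f i) | i : 'I_p <- enum 'I_p & (d <= i)%N].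
have -> : angle_bivector d theta e f = \sum_(a <- l) a.1 *: a.2.
  rewrite /l big_map big_filter big_enum_cond /= /angle_bivector.
  rewrite (bigID (fun i : 'I_p => (d <= i)%N)) /= [X in _ + X]big1 ?addr0 // => i.
  by rewrite -ltnNge ltn_dim_cap => /eqP ->; rewrite scale0r.
have comm_vec (u v w : 'rV[R]_n) : dotv u v = 0 -> dotv u w = 0 ->
    GRing.comm (vec u) (vec v * vec w).
  move=> uv uw; rewrite /GRing.comm mulrA (vec_anticomm uv) mulNr -(mulrA (vec v) (vec u)).
  by rewrite (vec_anticomm uw) mulrN opprK mulrA.
have lP a : a \in l -> exists2 i : 'I_p, (d <= i)%N & a.2 = vec (ep i) * vec (tnth f i).
  move=> /mapP [i]; rewrite mem_filter => /andP [di _] ->; exists i => //.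
  exact: pbivectorE.
rewrite mvexp_comm_sqrN1; first last.
- move=> a b /lP [i di ->] /lP [j dj ->]; have [->|ij] := eqVneq i j; first exact: commr_refl.
  apply: commr_sym; apply: commrM; apply: commr_sym; apply: comm_vec.
  + by rewrite dotv_eperp // (negPf ij).
  + exact: dotv_eperp_f.
  + by rewrite dotvC dotv_eperp_f.
  + by rewrite dotv_ff (negPf ij).
- move=> a /lP [i di ->]; rewrite -mulrA (mulrA (vec (tnth f i))) vec_anticomm; last first.
    by rewrite dotvC dotv_eperp_f.
  rewrite mulNr mulrN -!mulrA vec_sqr dotv_ff mulrA vec_sqr dotv_eperp // !eqxx.
  by rewrite !scale1r mulr1.
(* The omitted indices may be restored: at angle 0 the product e_i f_i is 1. *)
have -> : \prod_(a <- l) (cos a.1 *: 1 + sin a.1 *: a.2) =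
    \prod_(i <- enum 'I_p) (vec (tnth e i) * vec (tnth f i)).
  rewrite /l big_map big_filter /=.
  rewrite big_mkcond; apply: eq_bigr => i _ /=.
  have -> : vec (tnth e i) * vec (tnth f i) =
      cos (theta i) *: 1 + sin (theta i) *: pbivector d e f i.
    rewrite {1}principal_decomp linearD !linearZ mulrDl -!scalerAl -pbivectorE.
    by rewrite vec_sqr dotv_ff eqxx scale1r.
  case: leqP => //; rewrite ltn_dim_cap => /eqP ->.
  by rewrite cos0 sin0 scale0r scale1r addr0.
rewrite prod_mul_rev ?enum_uniq // => [|i j _ _ ij]; last first.
  apply: comm_vec; first by rewrite dotvC dotv_ef eq_sym (negPf ij) mul0r.
  by rewrite dotv_ff (negPf ij).
have tE (t : p.-tuple 'rV[R]_n) : map (tnth t) (enum 'I_p) = t by rewrite map_tnth_enum.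
by rewrite -(tE e) -(tE f) -map_rev !big_map.
Qed.

(** * Expansion in coordinate blades and the meaning of its coefficients *)

Local Notation y k := (beta_sum d e f)`_k.
Local Notation idx k := (pair_ord dim_cap_le k).

Lemma dotv_e_beta_sum i (k : 'I_(2 * p - d)) :
  dotv (tnth e i) (y k) =
    (i == idx k)%:R * (if is_f d k then cos (theta i) else sin (theta i)).
Proof.
rewrite (nth_beta_sum e f dim_cap_le); case: ifPn => fk; first exact: dotv_ef.
exact/dotv_e_eperp/is_fN_ge.
Qed.

Lemma orthonormal_beta_sum : Defs.orthonormal [tuple y k | k < 2 * p - d].
Proof.
move=> k l; rewrite !tnth_mktuple !(nth_beta_sum e f dim_cap_le).
have neq : is_f d k != is_f d l -> (k == l) = false by apply: contraNF => /eqP ->.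
have eqp : is_f d k = is_f d l -> (idx k == idx l) = (k == l).
  move=> fkl; apply/eqP/eqP => [kl|-> //]; apply: val_inj.
  by apply: (pair_index_inj fkl); exact: (congr1 val kl).
case: ifPn => fk; case: ifPn => fl.
- by rewrite dotv_ff eqp // fk fl.
- by rewrite neq ?fk ?(negPf fl) // dotvC dotv_eperp_f // is_fN_ge.
- by rewrite neq ?fl ?(negPf fk) // dotv_eperp_f // is_fN_ge.
- by rewrite dotv_eperp ?is_fN_ge // eqp // (negPf fk) (negPf fl).
Qed.

Lemma mem_span_beta_sum (i : 'I_p) (b : bool) : (d <= i)%N || b ->
  (if b then tnth f i else ep i) \in <<[tuple y k | k < 2 * p - d]>>%VS.
Proof.
move=> dib; have dp := dim_cap_le; have ip := ltn_ord i.
(* Inverse of the position coding: within a pair, f_i comes one place after e_i^perp. *)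
pose k := if (i < d)%N then i : nat else (d + (i - d).*2 + b)%N.
have kp : (k < 2 * p - d)%N by rewrite /k; case: (b) {k dib}; case: (ltnP i d); lia.
have fk : is_f d k = b.
  by move: dib; rewrite /k /is_f; case: (b); case: (ltnP i d) => //= di; lia.
have ki : idx (Ordinal kp) = i.
  apply: val_inj; rewrite /= /pair_index; move: dib.
  rewrite /k; case: (b) {fk k kp}; case: (ltnP i d) => di /= _;
    rewrite ?di //; case: (ltnP _ d); lia.
have := nth_beta_sum e f dp (Ordinal kp).
rewrite (_ : pair_ord dp _ = i) ?fk; last by rewrite -[RHS]ki; apply: val_inj.
move=> <-; apply/memv_span/tnthP.
by exists (Ordinal kp); rewrite tnth_mktuple.
Qed.

Lemma prod_principal_expand :
  \prod_(v <- e) vec v =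
    \sum_(g : p.-tuple 'I_(2 * p - d) | increasing g)
      (\prod_i dotv (tnth e i) (y (tnth g i))) *: coord_blade e f g.
Proof.
have eE i : vec (tnth e i) = \sum_(k < 2 * p - d) dotv (tnth e i) (y k) *: vec (y k).
  rewrite {1}(span_orthonormalE orthonormal_beta_sum (_ : tnth e i \in _)).
    by rewrite linear_sum; apply: eq_bigr => k _; rewrite linearZ tnth_mktuple.
  rewrite principal_decomp memvD //.
    by apply/memvZ/(mem_span_beta_sum (b := true)); rewrite orbT.
  have [di|di] := leqP d i.
    by apply/memvZ/(mem_span_beta_sum (b := false)); rewrite orbF.
  rewrite (_ : sin _ = 0) ?scale0r ?mem0v //.
  by apply/eqP; rewrite sin_principal_eq0 -ltn_dim_cap.
rewrite big_tuple; under eq_bigr => i _ do rewrite eE.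
rewrite prod_sum_tuple [RHS]big_mkcond; apply: eq_bigr => g _.
case: ifPn => // /negP g_incr.
suff [i /eqP gi] : exists i, dotv (tnth e i) (y (tnth g i)) == 0.
  by rewrite (bigD1 i) //= gi mul0r scale0r.
(* If no factor vanishes, [pair_index] sends each [tnth g i] to [i]; being monotone, it forces [g]
   to increase. *)
apply/existsP; apply: contra_notT g_incr; rewrite negb_exists => /forallP g0.
have gE i : pair_index d (tnth g i) = i.
  have := g0 i; rewrite dotv_e_beta_sum; case: (i =P _) => [ig _|_].
    exact: (congr1 val (esym ig)).
  by rewrite mul0r eqxx.
apply: ltn_increasing => i j ij; rewrite ltnNge; apply: contraL ij => /(@pair_index_mono d).
by rewrite !gE -leqNgt.
Qed.

Lemma proj_factor_coord_blade (g : p.-tuple 'I_(2 * p - d)) : increasing g ->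
  proj_factor V (blade_space (coord_blade e f g)) =
    \prod_i dotv (tnth e i) (y (tnth g i)).
Proof.
move=> g_incr; have [[eV oe] _ _ _ _] := hef.
pose s := [tuple y (tnth g i) | i < p].
have os : Defs.orthonormal s.
  move=> i j; have := orthonormal_beta_sum (tnth g i) (tnth g j).
  rewrite !tnth_mktuple => ->; congr (_%:R); congr nat_of_bool.
  apply/eqP/eqP => [gij|-> //]; apply: val_inj; have [||//] := ltngtP i j.
    by move=> /(increasing_ltn g_incr); rewrite gij ltnn.
  by move=> /(increasing_ltn g_incr); rewrite gij ltnn.
have -> : coord_blade e f g = \prod_(v <- s) vec v.
  by rewrite /coord_blade !big_tuple; apply: eq_bigr => i _; rewrite tnth_mktuple.
rewrite blade_space_orthonormal // (proj_factor_orthonormal eV oe os).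
(* Column [j] of the matrix can be nonzero only in the row of the plane containing its basis
   vector. *)
have b_homo : {homo (fun i => idx (tnth g i)) : i j / (i <= j)%N}.
  move=> i j; rewrite leq_eqVlt => /predU1P [/val_inj -> //|/(increasing_ltn g_incr) gij].
  exact/pair_index_mono/ltnW.
rewrite (det_staircase b_homo) => [|i j]; last first.
  by rewrite mxE tnth_mktuple dotv_e_beta_sum eq_sym => /negPf ->; rewrite mul0r.
rewrite ger0_norm; first by apply: eq_bigr => i _; rewrite mxE tnth_mktuple.
apply: prodr_ge0 => i _; rewrite mxE tnth_mktuple dotv_e_beta_sum mulr_ge0 //.
by case: ifP; rewrite ?cos_principal_ge0 ?sin_principal_ge0.
Qed.

(** The projection factor is a product of numbers in [0, 1], so it lies where [cos] inverts
    [acos]. *)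
Lemma cos_asym_angle_coord_blade (g : p.-tuple 'I_(2 * p - d)) : increasing g ->
  cos (asym_angle V (blade_space (coord_blade e f g))) =
    proj_factor V (blade_space (coord_blade e f g)).
Proof.
move=> g_incr; apply: acosK; rewrite in_itv /= (proj_factor_coord_blade g_incr).
have h i : 0 <= dotv (tnth e i) (y (tnth g i)) <= 1.
  rewrite dotv_e_beta_sum; case: eqP => _; rewrite ?mul0r ?lexx ?ler01 // mul1r.
  case: ifP => _; first by rewrite cos_principal_ge0 cos_le1.
  by rewrite sin_principal_ge0 sin_le1.
rewrite prodr_ile1 // andbT (le_trans (lerN10 R)) // prodr_ge0 // => i _.
by case/andP: (h i).
Qed.

End Principal.

(** * The exponential as a sum over coordinate subspaces *)

Theorem proposition3p24 (R : realType) (n p : nat) (hp : (1 <= p)%N)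
    (V W : {vspace 'rV[R]_n}) (hV : \dim V = p) (hW : \dim W = p)
    (theta : 'I_p -> R) (e f : p.-tuple 'rV[R]_n)
    (hef : principal_bases V W theta e f) :
  let d := \dim (V :&: W)%VS in
  let C := coord_blade (d := d) e f in
  let Y := fun j => blade_space (C j) in
  mvexp (angle_bivector d theta e f) =
    \sum_(j : p.-tuple 'I_(2 * p - d) | increasing j)
      cos (asym_angle V (Y j)) *: sigma f (C j)
  /\
  \sum_(j : p.-tuple 'I_(2 * p - d) | increasing j)
      cos (asym_angle V (Y j)) *: sigma f (C j) =
    \sum_(j : p.-tuple 'I_(2 * p - d) | increasing j)
      proj_factor V (Y j) *: sigma f (C j).
Proof.
move=> d C Y.
have cosE : \sum_(j : p.-tuple 'I_(2 * p - d) | increasing j)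
      cos (asym_angle V (Y j)) *: sigma f (C j) =
    \sum_(j : p.-tuple 'I_(2 * p - d) | increasing j)
      proj_factor V (Y j) *: sigma f (C j).
  apply: eq_bigr => j j_incr; congr (_ *: _).
  exact: (cos_asym_angle_coord_blade hef).
split=> //; rewrite cosE (mvexp_angle_bivector hef) (prod_principal_expand hef).
rewrite mulr_suml; apply: eq_bigr => j j_incr.
by rewrite -scalerAl /Y /C (proj_factor_coord_blade hef).
Qed.
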